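(* There exists a universal constant $c>0$ such that for all $T\in\mathbb{N}$, all $\rho\ge 1$, and every stochastic optimization algorithm $\mathsf{alg}\in\mathcal{A}_{\mathsf{SO}}$, $$\mathsf{PoA}_T^{\mathbb{E}}\big(\mathsf{alg},\mathcal{M}_{\mathsf{Lip}}^{1,\rho}\big)\;\ge\; c\,\min\big\{\sqrt{\log\rho},\,\sqrt{T}\big\}.$$
   Context: Here $\mathbb{N}=\{1,2,\dots\}$, $\log$ is the natural logarithm, and the domain is $\mathcal{X}=\mathbb{R}$. Stochastic optimization (SO) instances. An SO instance is a pair $(f,P)$, where $P$ is a probability distribution on a sample space $\mathcal{S}$ and $f:\mathcal{X}\times\mathcal{S}\to\mathbb{R}$ is such that $F_{f,P}(x):=\mathbb{E}_{S\sim P}f(x;S)$ is well defined and finite for all $x\in\mathcal{X}$. Let $X^\star_{f,P}:=\arg\min_{x\in\mathcal{X}}F_{f,P}(x)$. The norm of a set means the infimum of the norms of its elements ($\infty$ for the empty set). For $L,R>0$, $\mathcal{I}_{\mathsf{Lip}}^{L,R}$ is the class of instances $(f,P)$ such that $f(\cdot;s)$ is convex and $L$-Lipschitz on $\mathcal{X}$ for all $s\in\mathcal{S}$, and $\|X^\star_{f,P}\|\le R$. Algorithms. $\mathcal{A}_{\mathsf{SO}}$ is the set of all SO algorithms: given $T$ samples $S_1,\dots,S_T$ drawn i.i.d. from $P$ and independent $\xi\sim\mathsf{Unif}([0,1])$, the output is $x_T=\mathsf{alg}_T(f(\cdot;S_1),\dots,f(\cdot;S_T);\xi)\in\mathcal{X}$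 for some measurable mapping $\mathsf{alg}_T$. Expected error. $\mathsf{Err}_T^{\mathbb{E}}(\mathsf{alg},(f,P)):=\mathbb{E}F_{f,P}(x_T)-\inf_{x\in\mathcal{X}}F_{f,P}(x)$, where the expectation is over $S_1,\dots,S_T,\xi$. For a class $\mathcal{I}$ of instances, $\mathsf{Err}_T^{\mathbb{E}}(\mathsf{alg},\mathcal{I}):=\sup_{(f,P)\in\mathcal{I}}\mathsf{Err}_T^{\mathbb{E}}(\mathsf{alg},(f,P))$, and $\mathsf{Err}_T^{\mathbb{E}}(\mathcal{A}_{\mathsf{SO}},\mathcal{I}):=\inf_{\mathsf{alg}\in\mathcal{A}_{\mathsf{SO}}}\mathsf{Err}_T^{\mathbb{E}}(\mathsf{alg},\mathcal{I})$. Price of adaptivity. For $\ell,\rho\ge1$, $\mathcal{M}_{\mathsf{Lip}}^{\ell,\rho}:=\{\mathcal{I}_{\mathsf{Lip}}^{L,R}: L\in[1,\ell],\,R\in[1,\rho]\}$ (so for $\ell=1$ only $L=1$ occurs). For a collection $\mathcal{M}$ of instance classes, $\mathsf{PoA}_T^{\mathbb{E}}(\mathsf{alg},\mathcal{M}):=\sup_{\mathcal{I}\in\mathcal{M}}\dfrac{\mathsf{Err}_T^{\mathbb{E}}(\mathsf{alg},\mathcal{I})}{\mathsf{Err}_T^{\mathbb{E}}(\mathcal{A}_{\mathsf{SO}},\mathcal{I})}$. *)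

(* Defs.v *)
From HB Require Import structures.
From mathcomp Require Import all_boot all_order all_algebra.
From mathcomp Require Import all_classical all_reals all_analysis.

Set Implicit Arguments.
Unset Strict Implicit.
Unset Printing Implicit Defensive.

Import Order.TTheory GRing.Theory Num.Theory.
Import numFieldNormedType.Exports.

Local Open Scope classical_set_scope.
Local Open Scope ring_scope.

Section function_space.
Variable R : realType.

Definition cylinders : set (set (R -> R)) :=
  [set A | exists x (B : set R), measurable B /\ A = [set g | B (g x)]].

(* The measurable space of objective functions [R -> R]: the smallest
   sigma-algebra making all evaluations [g |-> g x] measurable.  Its trace on
   the continuous functions (hence on the convex ones) is the Borel
   sigma-algebra of locally uniform convergence. *)
Definition fspace := g_sigma_algebraType cylinders.

End function_space.

Section iid.
Context d (S : measurableType d) (R : realType) (P : probability S R).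

Definition tcons n (w : S * n.-tuple S) : n.+1.-tuple S :=
  [tuple of w.1 :: w.2].

Lemma measurable_tcons n : measurable_fun setT (@tcons n).
Proof. exact: measurable_cons. Qed.

HB.instance Definition _ n :=
  isMeasurableFun.Build _ _ _ _ (@tcons n) (@measurable_tcons n).

(* The law P^n of n i.i.d. samples; [iidE] gives its value on boxes, which
   determines it. *)
Fixpoint iid n : probability (n.-tuple S) R :=
  match n with
  | 0 => dirac ([tuple] : 0.-tuple S)
  | m.+1 => distribution (P \x iid m)%E (@tcons m)
  end.

Lemma iidE n (A : 'I_n -> set S) : (forall i, measurable (A i)) ->
  iid n [set t | forall i, A i (tnth t i)] = (\prod_(i < n) P (A i))%E.
Proof.
elim: n A => [|n ih] A mA.
  rewrite big_ord0 /= diracE mem_set// => -[].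
  by case.
rewrite big_ord_recl /= /distribution /pushforward.
rewrite -ih; last by move=> i; exact: mA.
rewrite -product_measure1E//.
- congr (_ _); apply/seteqP; split => -[x t] /=.
    by move=> H; split; [exact: (H ord0)|move=> i; have := H (lift ord0 i); rewrite tnthS].
  move=> [Ax At] i; case: (unliftP ord0 i) => [j ->|->//].
  by rewrite tnthS.
- have -> : [set t : n.-tuple S | forall i, A (lift ord0 i) (tnth t i)] =
      \bigcap_(i in [set: 'I_n]) ((fun t => tnth t i) @^-1` A (lift ord0 i)).
    by apply/seteqP; split => t /= H i => [_|]; apply: H.
  apply: fin_bigcap_measurable => // i _.
  rewrite -[X in measurable X]setTI; apply: measurable_tnth => //.
Qed.

End iid.

Section stochastic_optimization.
Variable R : realType.

Record SOinst := {
  disp : measure_display;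
  sample : measurableType disp;
  law : probability sample R;
  obj : R -> sample -> R;
  obj_integrable : forall x, law.-integrable setT (EFin \o obj x) }.
Arguments obj : clear implicits.

Definition risk (p : SOinst) (x : R) : R :=
  Rintegral (law p) setT (obj p x).

Definition argmin (F : R -> R) : set R := [set x | forall y, F x <= F y].

Definition set_norm (A : set R) : \bar R := ereal_inf [set `|x|%:E | x in A].

(* Plain predicates: [SOinst R] quantifies over all measurable sample spaces
   and is too large a type for [set]. *)
Definition inst_class := SOinst -> Prop.

Definition I_Lip (L rho : R) : inst_class := fun p =>
  [/\ forall s, convex_function setT ((obj p)^~ s : R^o -> R^o),
      forall s, L.-lipschitz ((obj p)^~ s : R^o -> R^o) &
      (set_norm (argmin (risk p)) <= rho%:E)%E].

(* An algorithm is a sequence (alg_T)_T of measurable maps.  The seed xi is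
   declared real, but is only ever drawn from Unif([0,1]). *)
Definition SOalg :=
  forall T : nat, {mfun (T.-tuple (fspace R) * R)%type >-> R}.

Definition output (alg : SOalg) T (p : SOinst)
    (w : T.-tuple (sample p) * R) : R :=
  alg T (map_tuple (fun s => (obj p)^~ s : fspace R) w.1, w.2).

Definition Err_inst T (alg : SOalg) (p : SOinst) : \bar R :=
  ((\int[iid (law p) T \x uniform_prob (@ltr01 R)]_w
       (risk p (output alg w))%:E)
   - ereal_inf [set (risk p x)%:E | x in setT])%E.

Definition Err_class T (alg : SOalg) (I : inst_class) : \bar R :=
  ereal_sup [set e | exists2 p, I p & e = Err_inst T alg p].

Definition Err_minimax T (I : inst_class) : \bar R :=
  ereal_inf [set Err_class T alg I | alg in [set: SOalg]].

Definition M_Lip (l r : R) : inst_class -> Prop := fun I =>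
  exists L rho : R, [/\ 1 <= L <= l, 1 <= rho <= r & I = I_Lip L rho].

(* On the classes [I_Lip L rho] with [L, rho >= 1] and [0 < T], the
   denominator is finite and positive, so that the library's conventions for
   division by 0 and infinity play no role. *)
Definition PoA T (alg : SOalg) (M : inst_class -> Prop) : \bar R :=
  ereal_sup [set e | exists2 I, M I &
    e = (Err_class T alg I / Err_minimax T I)%E].

End stochastic_optimization.
Arguments obj {R}.

(* Main.v *)
(* The denominator is at most 12 r / sqrt T: let xhat minimize the empirical risk
   over a uniform grid of T + 1 points around the origin.  Then F(xhat) exceeds
   the best grid value by at most the sum, over the grid cells, of the deviations
   |F - Fhat| of the increments; each has expectation at most (cell length) * 2 /
   sqrt T, so the sum is O(r / sqrt T) without any chaining.

   For the numerator, let f(x; 1) = |x - rho| and f(x; 0) = |x| and draw s = 1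
   with probability (1 - delta) / 2 or (1 + delta) / 2.  The minimizer is 0 in
   the first case and rho in the second, with excess risk delta |x| and
   delta |x - rho| at least.  With g = min(1, |x_T| / rho), a chi-square change
   of measure gives E_2 g <= rho E_1 g + (1 + O(delta^2))^T / (4 rho).  If
   delta^2 T is a small multiple of min(log rho, T), the last term is at most
   1/4, so either the first error is at least 3 delta / 8, which is large for
   the class of radius 1, or the second is at least 3 delta rho / 8, which is
   large for the class of radius rho. *)
Require Import Defs.
From mathcomp Require Import all_boot all_order all_algebra.
From mathcomp Require Import all_classical all_reals all_analysis.
From mathcomp Require Import measurable_realfun ring lra.
Import Order.TTheory GRing.Theory Num.Theory.
Import numFieldNormedType.Exports.
Local Open Scope classical_set_scope.
Local Open Scope ring_scope.
Set Implicit Arguments.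
Unset Strict Implicit.
Unset Printing Implicit Defensive.

(** * Integration *)

Section integral.
Context d (T : measurableType d) (R : realType).

(** Comparing positive and negative parts separately also covers infinite integrals, such as the
    expected risk of an algorithm whose output has heavy tails. *)
Lemma le_integral_measurable (mu : {measure set T -> \bar R})
    (f g : T -> \bar R) :
  measurable_fun setT f -> measurable_fun setT g -> (forall x, f x <= g x)%E ->
  (\int[mu]_x f x <= \int[mu]_x g x)%E.
Proof.
move=> mf mg fg; rewrite integralE [leRHS]integralE.
have leD : {in setT, forall x, (f x <= g x)%E} by move=> x _; exact: fg.
apply: leeB; apply: ge0_le_integral => //; try exact: measurable_funepos;
  try exact: measurable_funeneg.
- by move=> x _; apply: (funepos_le leD); rewrite inE.
- by move=> x _; apply: (funeneg_le leD); rewrite inE.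
Qed.

Lemma integral_cstD (P : probability T R) (c : R) (f : T -> R) :
  P.-integrable setT (EFin \o f) ->
  (\int[P]_x (c + f x)%:E = c%:E + \int[P]_x (f x)%:E)%E.
Proof.
move=> fi; under eq_integral do rewrite EFinD.
rewrite integralD//; last first.
  exact: (finite_measure_integrable_cst P c).
rewrite integral_cst//=.
by rewrite -[X in (_ * X + _)%E]/(P setT) probability_setT mule1.
Qed.

Lemma bounded_integrable (P : probability T R) (B : R) (f : T -> R) :
  measurable_fun setT f -> (forall x, `|f x| <= B) ->
  P.-integrable setT (EFin \o f).
Proof.
move=> mf fB; apply: measurable_bounded_integrable => //.
  by rewrite -[X in (X < _)%E]/(P setT) probability_setT ltry.
by exists B; split; [exact: num_real|move=> x Bx y _; exact: le_trans (fB y) (ltW Bx)].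
Qed.

Lemma ge0_integral_cstD (P : probability T R) (c v : R) (f : T -> R) :
  measurable_fun setT f -> (forall x, 0 <= f x) ->
  (\int[P]_x (f x)%:E <= v%:E)%E ->
  (\int[P]_x (c + f x)%:E <= (c + v)%:E)%E.
Proof.
move=> mf f0 fv; rewrite integral_cstD ?EFinD ?leeD2l//.
apply/integrableP; split; first exact/measurable_EFinP.
under eq_integral do rewrite /= ger0_norm//.
exact: le_lt_trans fv (ltry _).
Qed.

End integral.

(** * Integrals against the law of i.i.d. samples *)

Section iid.
Context d (S : measurableType d) (R : realType).
Implicit Type P : probability S R.

Lemma ge0_integral_iidS P n (f : n.+1.-tuple S -> \bar R) :
  measurable_fun setT f -> (forall t, 0 <= f t)%E ->
  (\int[iid P n.+1]_t f t =
   \int[P]_s \int[iid P n]_t f [tuple of s :: t])%E.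
Proof.
move=> mf f0 /=; rewrite ge0_integral_distribution//.
rewrite fubini_tonelli1//=.
by apply: measurableT_comp => //; exact: measurable_tcons.
Qed.

Lemma measurable_iid_section P n (f : n.+1.-tuple S -> \bar R) :
  measurable_fun setT f -> (forall t, 0 <= f t)%E ->
  measurable_fun setT
    (fun s => \int[iid P n]_t f [tuple of s :: t])%E.
Proof.
move=> mf f0.
apply: (@measurable_fun_fubini_tonelli_F _ _ _ _ _ (iid P n)
  (fun w => f (tcons w))) => //.
by apply: measurableT_comp => //; exact: measurable_tcons.
Qed.

(** The offset [a] makes the induction work: integrating out all samples but the first, [s], the
    induction hypothesis applies with offset [a + Y s], and after expanding the square the cross
    term [2 * a * Y s] has mean zero. *)
Lemma second_moment_iid P (Y : S -> R) (H : R) :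
  measurable_fun setT Y -> (forall s, `|Y s| <= H) ->
  (\int[P]_s (Y s)%:E = 0)%E -> forall n a,
  (\int[iid P n]_t ((a + \sum_(i < n) Y (tnth t i)) ^+ 2)%:E
    <= (a ^+ 2 + n%:R * H ^+ 2)%:E)%E.
Proof.
move=> mY YH Y0; have mS n a : measurable_fun setT
    (fun t : n.-tuple S => (a + \sum_(i < n) Y (tnth t i)) ^+ 2).
  apply: measurable_funX; apply: measurable_funD => //.
  apply: measurable_sum => i. apply: measurableT_comp => //.
  exact: measurable_tnth.
elim=> [|n IH] a.
  rewrite integral_dirac; [|by []|apply/measurable_EFinP; exact: (mS 0%N)].
  by rewrite diracT mul1e big_ord0 addr0 mul0r addr0.
rewrite ge0_integral_iidS//; last first.
- by move=> t; rewrite lee_fin sqr_ge0.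
- apply/measurable_EFinP; exact: mS.
have step s : (\int[iid P n]_t
    ((a + \sum_(i < n.+1) Y (tnth [tuple of s :: t] i)) ^+ 2)%:E
    <= ((a ^+ 2 + n.+1%:R * H ^+ 2) + 2 * a * Y s)%:E)%E.
  under eq_integral => t _.
    rewrite big_ord_recl tnth0 addrA.
    under eq_bigr do rewrite tnthS.
    over.
  apply: le_trans (IH _) _; rewrite lee_fin.
  have : Y s ^+ 2 <= H ^+ 2.
    by rewrite -(real_normK (num_real (Y s))) lerXn2r ?nnegrE// (le_trans _ (YH s)).
  by rewrite -natr1; nra.
apply: (le_trans (ge0_le_integral _ _ _ _ _ (fun s _ => step s))) => //.
- by move=> s _; apply: integral_ge0 => t _; rewrite lee_fin sqr_ge0.
- apply: (@measurable_iid_section P n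
    (fun t => ((a + \sum_(i < n.+1) Y (tnth t i)) ^+ 2)%:E)).
    by apply/measurable_EFinP; exact: mS.
  by move=> t; rewrite lee_fin sqr_ge0.
- apply/measurable_EFinP; apply: measurable_funD => //; exact: measurable_funM.
have iY := bounded_integrable P mY YH.
rewrite integral_cstD; last first.
  apply: (@bounded_integrable _ _ _ _ (`|2 * a| * H)); first exact: measurable_funM.
  by move=> s; rewrite normrM ler_wpM2l.
under eq_integral do rewrite EFinM.
by rewrite integralZl// Y0 mule0 adde0.
Qed.

End iid.

(** * Change of measure *)

Section change_of_measure.
Variable R : realType.

Lemma le_prob_integral1 d (T : measurableType d) (P : probability T R)
    (g : T -> \bar R) :
  measurable_fun setT g -> (forall t, 0 <= g t <= 1)%E ->
  (0 <= \int[P]_t g t <= 1)%E.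
Proof.
move=> mg g01; have g0 t : (0 <= g t)%E by have /andP[] := g01 t.
rewrite integral_ge0//=; apply: (@le_trans _ _ (\int[P]_t cst 1 t)%E).
  by apply: ge0_le_integral => // t _; have /andP[] := g01 t.
by rewrite integral_cst// mul1e probability_le1.
Qed.

(* The base of the n-th power is E_P[(dQ/dP)^2]: pointwise,
   dQ/dP <= theta + (dQ/dP)^2 / (4 theta).  Proving the integrated inequality by
   induction on n, with theta rescaled at each step, avoids product densities. *)
Lemma integral_bernoulli_iid_change (p q : R) : 0 < p < 1 -> 0 < q < 1 ->
  forall n (g : n.-tuple bool -> \bar R) (theta : R),
  measurable_fun setT g -> (forall t, 0 <= g t <= 1)%E -> 0 < theta ->
  (\int[iid (bernoulli_prob q) n]_t g t <=
   theta%:E * \int[iid (bernoulli_prob p) n]_t g t +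
   ((q ^+ 2 / p + (1 - q) ^+ 2 / (1 - p)) ^+ n / (4 * theta))%:E)%E.
Proof.
move=> /andP[p0 p1] /andP[q0 q1].
set M := _ / p + _.
elim=> [|n IH] g th mg g01 th0.
  rewrite !integral_dirac// !diracT !mul1e expr0.
  have := g01 [tuple]; case: (g [tuple]) => [x| |]; last 2 first.
  - by move=> /andP[_]; rewrite leye_eq.
  - by rewrite leeNy_eq.
  rewrite !lee_fin => /andP[x0 x1].
  (* Without samples the claim is about one number x in [0, 1]. For th > 1 the left side is
     nonpositive; otherwise x <= 1 reduces it to 4 th (1 - th) <= 1, that is (2 th - 1)^2 >= 0. *)
  suff : (1 - th) * x <= 1 / (4 * th) by lra.
  rewrite ler_pdivlMr ?mulr_gt0//; have [th1|th1] := leP th 1; last first.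
    apply: le_trans ler01; rewrite mulr_le0_ge0 ?mulr_ge0 ?(ltW th0)//.
    by rewrite mulr_le0_ge0// subr_le0 ltW.
  apply: (@le_trans _ _ ((1 - th) * (4 * th))); last first.
    by have := sqr_ge0 (2 * th - 1); rewrite expr2; lra.
  by rewrite ler_wpM2r ?mulr_ge0 ?(ltW th0)// ler_piMr ?subr_ge0.
have g0 t : (0 <= g t)%E by have /andP[] := g01 t.
have mcons (s : bool) :
    measurable_fun setT (fun t : n.-tuple bool => g [tuple of s :: t]).
  have mc : measurable_fun setT
      (fun t : n.-tuple bool => [tuple of s :: t] : n.+1.-tuple bool).
    by apply: (@measurable_cons _ _ _ _ (cst s)) => //; exact: measurable_id.
  exact: (measurableT_comp mg mc).
have p'0 : 0 < 1 - p by rewrite subr_gt0.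
have q'0 : 0 < 1 - q by rewrite subr_gt0.
have I01 P s := le_prob_integral1 (iid P n) (mcons s) (fun t => g01 _).
have pI : 0 <= p <= 1 by rewrite !ltW.
have qI : 0 <= q <= 1 by rewrite !ltW.
rewrite !ge0_integral_iidS// !integral_bernoulli_prob//; last 2 first.
- by move=> s; apply: integral_ge0.
- by move=> s; apply: integral_ge0.
pose F (P : probability bool R) s := (\int[iid P n]_t g [tuple of s :: t])%E.
pose Qt := F (bernoulli_prob q) true; pose Qf := F (bernoulli_prob q) false.
pose Pt := F (bernoulli_prob p) true; pose Pf := F (bernoulli_prob p) false.
change (q%:E * Qt + (1 - q)%:E * Qf <=
  th%:E * (p%:E * Pt + (1 - p)%:E * Pf) + (M ^+ n.+1 / (4 * th))%:E)%E.
have Qt01 : (0 <= Qt <= 1)%E := I01 _ true.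
have Qf01 : (0 <= Qf <= 1)%E := I01 _ false.
have Pt01 : (0 <= Pt <= 1)%E := I01 _ true.
have Pf01 : (0 <= Pf <= 1)%E := I01 _ false.
(* Rescaling th by dP/dQ recombines the two linear terms into the integral with
   respect to P, and the two constant terms into M ^+ n.+1 / (4 * th). *)
have : (Qt <= (th * p / q)%:E * Pt + (M ^+ n / (4 * (th * p / q)))%:E)%E
  := IH _ _ (mcons true) (fun t => g01 _) (divr_gt0 (mulr_gt0 th0 p0) q0).
have : (Qf <= (th * (1 - p) / (1 - q))%:E * Pf +
              (M ^+ n / (4 * (th * (1 - p) / (1 - q))))%:E)%E
  := IH _ _ (mcons false) (fun t => g01 _) (divr_gt0 (mulr_gt0 th0 p'0) q'0).
have fin (x : \bar R) : (0 <= x <= 1)%E -> exists r : R, x = r%:E.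
  by case: x => [r _||]; [exists r| rewrite leye_eq andbF|].
have [[x ->] [y ->] [z ->] [u ->]] :=
  And4 (fin _ Qt01) (fin _ Qf01) (fin _ Pt01) (fin _ Pf01).
rewrite -!EFinM -!EFinD !lee_fin => H2 H1.
have H1' := ler_wpM2l (ltW q0) H1.
have H2' := ler_wpM2l (ltW q'0) H2.
apply: le_trans (lerD H1' H2') _.
rewrite exprS; move: (M ^+ n) => K; rewrite /M le_eqVlt; apply/orP; left.
by apply/eqP; field; rewrite ?gt_eqF.
Qed.

End change_of_measure.

(** * Risk and expected error *)

Section risk.
Variable R : realType.
Implicit Types (p : SOinst R) (alg : SOalg R).

Lemma lipschitz1_measurable (F : R -> R) :
  (forall x y, `|F x - F y| <= `|x - y|) -> measurable_fun setT F.
Proof.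
move=> FL; apply: continuous_measurable_fun => x.
apply/cvgrPdist_lt => e e0; near=> y.
apply: le_lt_trans (FL x y) _; near: y.
have := @nbhsx_ballx _ R^o x e e0.
by apply: filterS => y; rewrite -ball_normE.
Unshelve. all: by end_near. Qed.

Lemma I_Lip_lipschitz1 (r : R) p : I_Lip 1 r p ->
  forall s x y, `|obj p x s - obj p y s| <= `|x - y|.
Proof.
move=> [_ L _] s x y; rewrite -[leRHS]mul1r.
exact: (L s (x, y) (conj Logic.I Logic.I)).
Qed.

Lemma risk_lipschitz1 p :
  (forall s x y, `|obj p x s - obj p y s| <= `|x - y|) ->
  forall x y, `|risk p x - risk p y| <= `|x - y|.
Proof.
move=> pL x y; rewrite /risk -RintegralB//; try exact: obj_integrable.
have iD : (law p).-integrable setT (EFin \o (fun s => obj p x s - obj p y s)).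
  by apply: (integrableB _ (obj_integrable p x) (obj_integrable p y)).
apply: (le_trans (le_normr_Rintegral _ iD)) => //.
apply: (@le_trans _ _ (\int[law p]_(s in setT) `|x - y|)); last first.
  rewrite Rintegral_cst// -[X in fine X]/(law p setT).
  by rewrite probability_setT/= mulr1.
apply: le_Rintegral => [//|||s _]; last exact: pL.
- exact: (integrable_abse iD).
- by apply: (@bounded_integrable _ _ _ (law p) `|x - y|) => // s; rewrite normr_id.
Qed.

Lemma measurable_output T alg p : measurable_fun setT (@output R alg T p).
Proof.
(* It suffices to test the generating cylinders, whose preimages are preimages under a single
   measurable function [obj p x]. *)
have mo : measurable_fun setT (fun s => (obj p)^~ s : fspace R).
  apply: (@measurability _ _ _ (g_sigma_algebraType (@cylinders R)) setT _
    (@cylinders R) erefl).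
  move=> _ [_ [x [B [mB ->]]] <-].
  have /measurable_EFinP mx := measurable_int _ (obj_integrable p x).
  exact: mx.
have mt : measurable_fun setT
    (map_tuple (fun s => (obj p)^~ s : fspace R) : T.-tuple (sample p) -> _).
  apply/measurable_fun_tnthP => i.
  rewrite (_ : _ \o _ = (fun s => (obj p)^~ s : fspace R) \o (fun t => tnth t i)).
    by apply: measurableT_comp => //; exact: measurable_tnth.
  by apply/funext => t /=; rewrite tnth_map.
apply: (measurableT_comp (@measurable_funPT _ _ _ _ (alg T))).
apply: measurable_fun_pair; last exact: measurable_snd.
by apply: measurableT_comp => //; exact: measurable_fst.
Qed.

Lemma inf_risk p x0 : (forall y, risk p x0 <= risk p y) ->
  ereal_inf [set (risk p x)%:E | x in setT] = (risk p x0)%:E.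
Proof.
move=> x0min; apply/eqP; rewrite eq_le; apply/andP; split.
  by apply: ereal_inf_lbound; exists x0.
by apply: le_ereal_inf_tmp => _ [x _ <-]; rewrite lee_fin.
Qed.

(** Since [k] is nonnegative, [x0] is a minimizer and [k] minorizes the excess risk. Boundedness of
    [k] makes its integral finite, so the minimal risk can be moved across the inequality even if
    the expected risk is infinite. *)
Lemma Err_inst_ge T alg p x0 (k : R -> R) (B : R) :
  measurable_fun setT (risk p) -> measurable_fun setT k ->
  (forall x, 0 <= k x <= B) -> (forall x, risk p x0 + k x <= risk p x) ->
  (\int[iid (law p) T \x uniform_prob (@ltr01 R)]_w (k (output alg w))%:E
   <= Err_inst T alg p)%E.
Proof.
move=> mF mk kB kF; have k0 x : 0 <= k x by have /andP[] := kB x.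
have mo := @measurable_output T alg p.
have mko : measurable_fun setT (fun w => k (@output R alg T p w)).
  exact: (measurableT_comp mk mo).
rewrite /Err_inst (@inf_risk p x0); last first.
  by move=> y; apply: le_trans (kF y); rewrite lerDl.
rewrite leeBrDr// addeC -integral_cstD; last first.
  apply: (@bounded_integrable _ _ _ _ B) => // w.
  by rewrite ger0_norm//; have /andP[] := kB (output alg w).
apply: le_integral_measurable => [||w]; last by rewrite lee_fin.
- by apply/measurable_EFinP; exact: measurable_funD.
- by apply/measurable_EFinP; exact: (measurableT_comp mF mo).
Qed.

Lemma Err_inst_le T alg p x0 (v : R) : (forall y, risk p x0 <= risk p y) ->
  (\int[iid (law p) T \x uniform_prob (@ltr01 R)]_w
    (risk p (output alg w))%:E <= (risk p x0 + v)%:E)%E ->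
  (Err_inst T alg p <= v%:E)%E.
Proof.
by move=> x0min H; rewrite /Err_inst (inf_risk x0min) leeBlDl// -EFinD.
Qed.

End risk.

(** * Grid empirical risk minimization *)

Section upper_bound.
Variable R : realType.

(** A running minimum: carrying the current best value [v] along with the selected point [ou] makes
    each update a measurable case distinction. *)
Lemma measurable_argmin d (T : measurableType d) (g : nat -> R)
    (s : nat -> T -> R) (N : nat) :
  (forall j, measurable_fun setT (s j)) ->
  exists ou v : T -> R, [/\ measurable_fun setT ou, measurable_fun setT v &
    forall w, exists2 j, (j <= N)%N &
      [/\ ou w = g j, v w = s j w & forall i, (i <= N)%N -> v w <= s i w]].
Proof.
move=> ms; elim: N => [|N [ou [v [mo mv ov]]]].
  exists (cst (g 0%N)), (s 0%N); split => // w.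
  by exists 0%N => //; split => // i; rewrite leqn0 => /eqP ->.
exists (fun w => if s N.+1 w < v w then g N.+1 else ou w),
  (fun w => if s N.+1 w < v w then s N.+1 w else v w); split.
- by apply: measurable_fun_ifT => //; exact: measurable_fun_ltr.
- by apply: measurable_fun_ifT => //; exact: measurable_fun_ltr.
- move=> w; have [j jN [oj vj jmin]] := ov w.
  have [lt|ge] := ltP (s N.+1 w) (v w).
    exists N.+1 => //; split => // i; rewrite leq_eqVlt => /predU1P[->//|].
    by rewrite ltnS => /jmin; apply: le_trans; exact: ltW.
  exists j; first exact: leqW.
  by split => // i; rewrite leq_eqVlt => /predU1P[->//|]; rewrite ltnS => /jmin.
Qed.

Lemma exists_empirical_argmin (T N : nat) (g : nat -> R) :
  exists A : {mfun (T.-tuple (fspace R) * R)%type >-> R},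
    forall w, exists2 j, (j <= N)%N & A w = g j /\
      forall i, (i <= N)%N -> \sum_(k < T) tnth w.1 k (g j)
                           <= \sum_(k < T) tnth w.1 k (g i).
Proof.
have meval x : measurable_fun setT (fun f : fspace R => f x).
  move=> _ B mB; rewrite setTI; apply: (@sub_sigma_algebra _ setT (@cylinders R)).
  by exists x, B.
have [|ou [v [mo mv ov]]] := @measurable_argmin _ (T.-tuple (fspace R) * R)%type
    g (fun j w => \sum_(k < T) tnth w.1 k (g j)) N.
  move=> j; apply: measurable_sum => k.
  have mk : measurable_fun setT
      (fun w : (T.-tuple (fspace R) * R)%type => tnth w.1 k).
    apply: (@measurableT_comp _ _ _ _ _ _
      (fun t : T.-tuple (fspace R) => tnth t k) _ fst).
      exact: measurable_tnth.
    exact: measurable_fst.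
  exact: (measurableT_comp (meval (g j)) mk).
exists (mfun_Sub (mem_set mo)) => w; have [j jN [oj vj jmin]] := ov w.
by exists j => //; split => // i /jmin; rewrite vj.
Qed.

(** The right side does not depend on [i] and [j], so the bound remains usable when an index is
    chosen from the data. *)
Lemma normr_telescope (u : nat -> R) n i j : (i <= n)%N -> (j <= n)%N ->
  `|u i - u j| <= \sum_(l < n) `|u l.+1 - u l|.
Proof.
wlog ij : i j / (j <= i)%N => [H|] iN jN.
  have [ij|/ltnW ij] := leqP j i; first exact: H.
  by rewrite distrC; exact: H.
rewrite -(telescope_sumr u ij); apply: (le_trans (ler_norm_sum _ _ _)).
rewrite -(big_mkord xpredT (fun l => `|u l.+1 - u l|)).
rewrite (big_cat_nat (leq0n j) jN)/= (big_cat_nat ij iN)/=.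
by rewrite addrCA lerDl addr_ge0// sumr_ge0.
Qed.

Lemma exists_grid_neighbor (a h x : R) n : 0 < h -> (0 < n)%N ->
  a <= x <= a + n%:R * h ->
  exists2 j, (j <= n)%N & `|x - (a + j%:R * h)| <= h.
Proof.
move=> h0; elim: n => [//| [_ _|n IH _]].
  rewrite mul1r => /andP[ax xh]; exists 0%N => //.
  by rewrite mul0r addr0 ger0_norm ?subr_ge0// lerBlDl.
move=> /andP[ax xn].
have [xn'|xn'] := leP x (a + n.+1%:R * h).
  by have [|j jn H] := IH isT; [rewrite ax|exists j => //; exact: leqW].
exists n.+1 => //; rewrite ger0_norm ?subr_ge0 ?(ltW xn')//.
by move: xn; rewrite -(natr1 n.+1); lra.
Qed.

Lemma ge0_integral_fst d1 d2 (S1 : measurableType d1) (S2 : measurableType d2)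
    (P : probability S1 R) (Q : probability S2 R) (f : S1 -> \bar R) :
  measurable_fun setT f -> (forall x, 0 <= f x)%E ->
  (\int[P \x Q]_w f w.1 = \int[P]_x f x)%E.
Proof.
move=> mf f0; rewrite fubini_tonelli1//=; last first.
  by apply: measurableT_comp => //; exact: measurable_fst.
apply: eq_integral => x _; rewrite /fubini_F/= integral_cst//.
by rewrite -[X in (_ * X)%E]/(Q setT) probability_setT mule1.
Qed.

(** * Deviations of the empirical risk along a grid *)

Section increments.
Variables (p : SOinst R) (g : nat -> R) (h : R).
Hypothesis pL : forall s x y, `|obj p x s - obj p y s| <= `|x - y|.
Hypothesis gh : forall l, `|g l.+1 - g l| <= h.

(** Summed over the samples, this gives T times the increment over cell [l] of empirical minus true
    risk. *)
Definition centered_increment l s : R :=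
  (obj p (g l.+1) s - obj p (g l) s) - (risk p (g l.+1) - risk p (g l)).

Lemma measurable_centered_increment l :
  measurable_fun setT (centered_increment l).
Proof.
have mo x := measurable_int _ (obj_integrable p x).
by apply: measurable_funB => //; apply: measurable_funB;
  apply/measurable_EFinP; exact: mo.
Qed.

Lemma centered_increment_bound l s : `|centered_increment l s| <= 2 * h.
Proof.
rewrite mulr_natl mulr2n; apply: (le_trans (ler_normB _ _)).
by apply: lerD; [apply: le_trans (pL _ _ _) _|
  apply: le_trans (risk_lipschitz1 pL _ _) _].
Qed.

Lemma integral_centered_increment l :
  (\int[law p]_s (centered_increment l s)%:E = 0)%E.
Proof.
have io := obj_integrable p.
have iD : (law p).-integrable setT
    (EFin \o (fun s => obj p (g l.+1) s - obj p (g l) s)).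
  by apply: (integrableB _ (io _) (io _)).
under eq_integral do rewrite /centered_increment addrC.
rewrite integral_cstD// -[X in (_ + X)%E]fineK; last exact: integrable_fin_num.
rewrite -EFinD -[X in - _ + X]/(Rintegral (law p) setT _).
by rewrite RintegralB// addNr.
Qed.

(** With [u] equal to T times empirical minus true risk on the grid, the empirical comparison of
    [g i] and [g j] bounds T times the risk difference by [u j - u i], which telescopes over the
    cells. *)
Lemma erm_regret T (t : T.-tuple (sample p)) n i j : (0 < T)%N ->
  (i <= n)%N -> (j <= n)%N ->
  \sum_(k < T) obj p (g i) (tnth t k) <= \sum_(k < T) obj p (g j) (tnth t k) ->
  risk p (g i) - risk p (g j) <=
    T%:R^-1 * \sum_(l < n) `|\sum_(k < T) centered_increment l (tnth t k)|.
Proof.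
move=> T0 iN jN ij; have Tr : 0 < T%:R :> R by rewrite ltr0n.
rewrite ler_pdivlMl//.
pose u i := \sum_(k < T) obj p (g i) (tnth t k) - T%:R * risk p (g i).
have uD l : \sum_(k < T) centered_increment l (tnth t k) = u l.+1 - u l.
  rewrite /u /centered_increment !sumrB !sumr_const card_ord.
  by rewrite -mulr_natl; ring.
under eq_bigr do rewrite uD.
apply: le_trans (normr_telescope u iN jN).
by rewrite distrC; apply: le_trans (ler_norm _); rewrite /u; lra.
Qed.

End increments.

(* The grid covers [-2r, 2r] rather than [-r, r] because the norm of the argmin
   set is an infimum: it only yields minimizers of norm less than 2r. *)
Lemma Err_minimax_le (T : nat) (r : R) : (0 < T)%N -> 0 < r ->
  (Err_minimax T (@I_Lip R 1 r) <= (12 * r / Num.sqrt T%:R)%:E)%E.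
Proof.
move=> T0 r0.
pose h : R := 4 * r / T%:R; pose g (j : nat) : R := - (2 * r) + j%:R * h.
pose algs : SOalg R := fun n => projT1 (cid (exists_empirical_argmin n T g)).
have Tr : 0 < T%:R :> R by rewrite ltr0n.
have h0 : 0 < h by rewrite divr_gt0 ?mulr_gt0.
have sT0 : 0 < Num.sqrt T%:R :> R by rewrite sqrtr_gt0.
have sT2 : Num.sqrt T%:R ^+ 2 = T%:R :> R by rewrite sqr_sqrtr// ltW.
have sT1 : 1 <= Num.sqrt T%:R :> R by rewrite -[leLHS]sqrtr1 ler_sqrt// ler1n.
have gh l : `|g l.+1 - g l| <= h.
  by rewrite /g -natr1 ger0_norm; [lra|have := h0; lra].
apply: (@le_trans _ _ (Err_class T algs (I_Lip 1 r))).
  by apply: ereal_inf_lbound; exists algs.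
apply: ge_ereal_sup => _ [p pI ->].
have pL := I_Lip_lipschitz1 pI; have FL := risk_lipschitz1 pL.
have [x0 x0min x0r] : exists2 x0, argmin (risk p) x0 & `|x0| < 2 * r.
  have [_ _ nr] := pI.
  have /ereal_inf_lt[_ [x xm <-] xr] : (set_norm (argmin (risk p)) < (2 * r)%:E)%E.
    by apply: le_lt_trans nr _; rewrite lte_fin; lra.
  by exists x => //; rewrite -lte_fin.
have [i0 i0T gi0] : exists2 i0, (i0 <= T)%N & `|x0 - g i0| <= h.
  apply: exists_grid_neighbor => //.
  have -> : T%:R * h = 4 * r by rewrite /h; field; rewrite gt_eqF.
  by move: x0r; rewrite ltr_norml => /andP[? ?]; apply/andP; split; lra.
(* An upper bound for the root mean square of each [D l] below, since T (2 h)^2 = K^2; hence the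
   right scale for balancing AM-GM. *)
pose K := 2 * h * Num.sqrt T%:R.
have K0 : 0 < K.
  apply: mulr_gt0; last exact: sT0.
  by apply: mulr_gt0.
have c0 : 0 <= (2 * K * T%:R)^-1 by rewrite invr_ge0 !mulr_ge0// ltW.
pose D l (t : T.-tuple (sample p)) :=
  \sum_(k < T) centered_increment g l (tnth t k).
have mD l : measurable_fun setT (D l).
  apply: measurable_sum => k.
  apply: measurableT_comp; last exact: measurable_tnth.
  exact: measurable_centered_increment.
(* The random part left by AM-GM; each of the T squares has mean at most K^2, so [Z] has mean at
   most K / 2. *)
pose Z (t : T.-tuple (sample p)) := (2 * K * T%:R)^-1 * \sum_(l < T) D l t ^+ 2.
have mZ : measurable_fun setT Z.
  apply: measurable_funM => //; apply: measurable_sum => l.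
  exact: measurable_funX.
have Z0 t : 0 <= Z t.
  rewrite mulr_ge0//.
  by apply: sumr_ge0 => l _; exact: sqr_ge0.
have EZ : (\int[iid (law p) T]_t (Z t)%:E <= (K / 2)%:E)%E.
  under eq_integral do rewrite EFinM -sumEFin.
  rewrite ge0_integralZl_EFin//; first last.
  - apply: emeasurable_sum => l; apply/measurable_EFinP; exact: measurable_funX.
  - by move=> t _; apply: sume_ge0 => l _; rewrite lee_fin sqr_ge0.
  rewrite ge0_integral_sum//; last 2 first.
  - by move=> l; apply/measurable_EFinP; exact: measurable_funX.
  - by move=> l t _; rewrite lee_fin sqr_ge0.
  have ED l : (\int[iid (law p) T]_t (D l t ^+ 2)%:E
      <= (T%:R * (2 * h) ^+ 2)%:E)%E.
    have := second_moment_iid (@measurable_centered_increment p g l)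
      (centered_increment_bound pL gh l) (@integral_centered_increment p g l) T 0.
    rewrite expr0n add0r; under eq_integral do rewrite add0r.
    by [].
  apply: (@le_trans _ _ (((2 * K * T%:R)^-1)%:E *
      \sum_(l < T) (T%:R * (2 * h) ^+ 2)%:E)%E).
    by apply: lee_wpmul2l => //; apply: lee_sum => l _; exact: ED.
  rewrite sumEFin -EFinM lee_fin sumr_const card_ord -[_ * _ *+ T]mulr_natl.
  rewrite le_eqVlt; apply/orP; left; apply/eqP.
  rewrite /K; move: sT2 sT0; move: (Num.sqrt T%:R) => s <- s0; field.
  by rewrite ?gt_eqF.
(* The term [h] pays for moving [x0] to a nearby grid point, and [K / 2 + Z] for the regret against
   that point. *)
have pointwise w : risk p (output algs w) <= (risk p x0 + h + K / 2) + Z w.1.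
  rewrite /output /algs.
  case: cid => A AP /=; have [j jT [-> jmin]] := AP (map_tuple (fun s => (obj p)^~ s : fspace R) w.1, w.2).
  have := jmin _ i0T; under eq_bigr do rewrite tnth_map.
  under [X in _ <= X]eq_bigr do rewrite tnth_map.
  move=> ji0; have := erm_regret T0 jT i0T ji0.
  (* AM-GM, so that second moments alone control the regret. *)
  have AG l : `|D l w.1| <= K / 2 + (2 * K)^-1 * D l w.1 ^+ 2.
    rewrite -(real_normK (num_real (D l w.1))); set y := `|_|.
    have -> : K / 2 + (2 * K)^-1 * y ^+ 2 = y + (2 * K)^-1 * (y - K) ^+ 2.
      by field; rewrite gt_eqF.
    by rewrite lerDl mulr_ge0 ?sqr_ge0// invr_ge0 mulr_ge0// ltW.
  have : T%:R^-1 * \sum_(l < T) `|D l w.1| <= K / 2 + Z w.1.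
    rewrite ler_pdivrMl//; apply: (@le_trans _ _
      (\sum_(l < T) (K / 2 + (2 * K)^-1 * D l w.1 ^+ 2))).
      by apply: ler_sum => l _; exact: AG.
    rewrite big_split/= sumr_const card_ord -mulr_sumr -[_ / 2 *+ T]mulr_natl /Z.
    by rewrite le_eqVlt; apply/orP; left; apply/eqP; field; rewrite ?gt_eqF.
  have := le_trans (ler_norm _) (le_trans (FL (g i0) x0) _).
  rewrite distrC => /(_ _ gi0).
  by rewrite /D; lra.
(* Here h + K = 4 r / T + 8 r / sqrt T, and T >= 1 bounds the first term by 4 r / sqrt T. *)
apply: (@le_trans _ _ (h + K)%:E); last first.
  rewrite lee_fin /K /h; move: sT2 sT0 sT1.
  move: (Num.sqrt T%:R) => s <- s0 s1; rewrite -subr_ge0.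
  have -> : 12 * r / s - (4 * r / s ^+ 2 + 2 * (4 * r / s ^+ 2) * s) =
      4 * r / s ^+ 2 * (s - 1) by field; rewrite gt_eqF.
  by rewrite mulr_ge0 ?subr_ge0// divr_ge0 ?exprn_ge0 ?mulr_ge0 ?(ltW r0) ?(ltW s0).
apply: (Err_inst_le x0min).
apply: le_trans (@le_integral_measurable _ _ _ _ _
  (fun w => (risk p x0 + h + K / 2 + Z w.1)%:E) _ _ _) _.
- apply/measurable_EFinP.
  exact: (measurableT_comp (lipschitz1_measurable FL) (@measurable_output _ _ algs p)).
- apply/measurable_EFinP; apply: measurable_funD => //.
  by apply: measurableT_comp => //; exact: measurable_fst.
- by move=> w; rewrite lee_fin.
have -> : risk p x0 + (h + K) = (risk p x0 + h + K / 2) + K / 2 by field.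
apply: ge0_integral_cstD => [||].
- by apply: measurableT_comp => //; exact: measurable_fst.
- by move=> w; exact: Z0.
rewrite (@ge0_integral_fst _ _ _ _ _ _ (fun t => (Z t)%:E))//.
exact/measurable_EFinP.
Qed.

End upper_bound.

(** * The two-point family *)

Section lower_bound.
Variable R : realType.

Definition two_point_obj (r x : R) (b : bool) : R :=
  if b then `|x - r| else `|x|.

Lemma two_point_obj_integrable p r x :
  (bernoulli_prob p : probability bool R).-integrable setT
    (EFin \o two_point_obj r x).
Proof.
apply: (@bounded_integrable _ _ _ _ (`|x - r| + `|x|)) => //.
by case; rewrite /two_point_obj normr_id ?lerDl ?lerDr.
Qed.

Definition two_point p r : SOinst R := @Build_SOinst R _ bool
  (bernoulli_prob p) (two_point_obj r) (two_point_obj_integrable p r).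

Lemma risk_two_point p r x : 0 <= p <= 1 ->
  risk (two_point p r) x = p * `|x - r| + (1 - p) * `|x|.
Proof.
move=> p01; rewrite /risk /Rintegral/= integral_bernoulli_prob//.
by case; rewrite lee_fin /two_point_obj.
Qed.

Lemma two_point_lipschitz1 p r s x y :
  `|obj (two_point p r) x s - obj (two_point p r) y s| <= `|x - y|.
Proof.
case: s => /=; rewrite /two_point_obj; last exact: ler_dist_dist.
by apply: (le_trans (ler_dist_dist _ _)); rewrite opprB addrA subrK.
Qed.

Lemma dist_convex (t a x y : R) : 0 <= t -> t <= 1 ->
  `|t * x + (1 - t) * y - a| <= t * `|x - a| + (1 - t) * `|y - a|.
Proof.
move=> t0 t1; have -> : t * x + (1 - t) * y - a = t * (x - a) + (1 - t) * (y - a).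
  by ring.
have t'0 : 0 <= 1 - t by rewrite subr_ge0.
apply: (le_trans (ler_normD _ _)).
by rewrite !normrM (ger0_norm t0) (ger0_norm t'0).
Qed.

Lemma two_point_I_Lip p r rho x0 :
  (forall x, risk (two_point p r) x0 <= risk (two_point p r) x) ->
  `|x0| <= rho -> I_Lip 1 rho (two_point p r).
Proof.
move=> x0min x0rho; split.
- move=> b t x y _ _; rewrite !convRE /= /unstable.onem.
  have t0 : 0 <= t%:num by [].
  have t1 : t%:num <= 1 by [].
  change (two_point_obj r (t%:num * (x : R) + (1 - t%:num) * (y : R)) b <=
    t%:num * two_point_obj r x b + (1 - t%:num) * two_point_obj r y b).
  case: b; rewrite /two_point_obj; first exact: dist_convex.
  by have := dist_convex 0 x y t0 t1; rewrite !subr0.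
- move=> s [x y] _; rewrite /= mul1r; exact: two_point_lipschitz1.
- by apply: (@le_trans _ _ `|x0|%:E); [apply: ereal_inf_lbound; exists x0|].
Qed.

(** Replacing |x - r| by its lower bound r - |x| leaves |x| with the difference of the two weights,
    (1 + delta) / 2 - (1 - delta) / 2 = delta, as coefficient. *)
Lemma risk_two_point_left (delta r x : R) : 0 < delta < 1 -> 0 < r ->
  risk (two_point ((1 - delta) / 2) r) 0 + delta * `|x|
    <= risk (two_point ((1 - delta) / 2) r) x.
Proof.
move=> /andP[d0 d1] r0.
rewrite !risk_two_point; try by apply/andP; split; lra.
have := ler_distD x r 0; rewrite !subr0 sub0r normrN normr0 (distrC r).
by rewrite (gtr0_norm r0); nra.
Qed.

Lemma risk_two_point_right (delta r x : R) : 0 < delta < 1 -> 0 < r ->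
  risk (two_point ((1 + delta) / 2) r) r + delta * `|x - r|
    <= risk (two_point ((1 + delta) / 2) r) x.
Proof.
move=> /andP[d0 d1] r0.
rewrite !risk_two_point; try by apply/andP; split; lra.
have := ler_distD x r 0; rewrite !subr0 subrr normr0 (distrC r).
by rewrite (gtr0_norm r0); nra.
Qed.

(* The witness a is the expectation of min(1, |x_T| / r) under the first
   instance; under the second one, 1 minus this function is a lower bound for
   |x_T - r| / r. *)
Lemma two_point_separation (T : nat) (alg : SOalg R) (r delta : R) :
  0 < r -> 0 < delta < 1 -> exists a : R,
  [/\ 0 <= a,
     ((delta * r * a)%:E <= Err_inst T alg (two_point ((1 - delta) / 2) r))%E &
     forall theta, 0 < theta ->
     ((delta * r * (1 - theta * a -
         (4 / (1 - delta ^+ 2) - 3) ^+ T / (4 * theta)))%:E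
       <= Err_inst T alg (two_point ((1 + delta) / 2) r))%E].
Proof.
move=> r0 d01; have /andP[d0 d1] := d01.
have dr0 : 0 < delta * r by rewrite mulr_gt0.
pose g (x : R) : R := Num.min 1 (`|x| / r).
have g0 x : 0 <= g x by rewrite /g le_min ler01 divr_ge0// ltW.
have g1 x : g x <= 1 by rewrite /g ge_min lexx.
have gx x : r * g x <= `|x|.
  by rewrite mulrC -ler_pdivlMr// /g ge_min lexx orbT.
have g1x x : r * (1 - g x) <= `|x - r|.
  have rx : r * (`|x| / r) = `|x| by rewrite mulrCA divff ?gt_eqF// mulr1.
  have := lerB_dist r x; rewrite distrC (gtr0_norm r0) /g /Num.min => rxB.
  case: ifP => _; first by rewrite subrr mulr0.
  by rewrite mulrBr rx mulr1.
have mg : measurable_fun setT g.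
  have mn : measurable_fun setT (fun x : R => `|x|).
    by apply: lipschitz1_measurable; exact: ler_dist_dist.
  apply: measurable_minr => //. exact: measurable_funM.
(* The output depends on the instance only through its objective, so the parameter 0 is arbitrary
   and one [phi] serves both instances. *)
pose phi (w : (T.-tuple bool * R)%type) : R :=
  g (@output R alg T (two_point 0 r) w).
have mphi : measurable_fun setT (EFin \o phi).
  apply/measurable_EFinP.
  exact: (measurableT_comp mg (@measurable_output _ T alg (two_point 0 r))).
have phi01 w : (0 <= (EFin \o phi) w)%E by rewrite lee_fin; exact: g0.
pose U := uniform_prob (@ltr01 R).
(* Averaging over the seed first leaves a [0, 1]-valued function of the samples alone, to which the
   change of measure applies. *)
pose H := fubini_F U (EFin \o phi).
have mH : measurable_fun setT H :=
  @measurable_fun_fubini_tonelli_F _ _ _ _ _ U _ mphi phi01.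
have H01 t : (0 <= H t <= 1)%E.
  apply: le_prob_integral1 => [|u]; last first.
    by rewrite !lee_fin; apply/andP; split; [exact: g0|exact: g1].
  exact: (measurableT_comp mphi (pair1_measurable t)).
pose I p : \bar R := (\int[iid (bernoulli_prob p : probability bool R) T]_t H t)%E.
have IE p : (\int[iid (bernoulli_prob p : probability bool R) T \x U]_w (phi w)%:E = I p)%E.
  by rewrite fubini_tonelli1.
have I01 p : (0 <= I p <= 1)%E by exact: le_prob_integral1.
have fI p : I p = (fine (I p))%:E.
  by move: (I01 p); case: (I p) => // /andP[]; rewrite ?leye_eq.
exists (fine (I ((1 - delta) / 2))); split.
- by apply: fine_ge0; have /andP[] := I01 ((1 - delta) / 2).
- apply: le_trans (@Err_inst_ge _ _ _ _ 0 (fun x => delta * r * g x) (delta * r) _ _ _ _).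
  + under eq_integral do rewrite EFinM.
    rewrite ge0_integralZl_EFin//; [by rewrite EFinM -fI -IE| |exact: ltW].
    by move=> w _; rewrite lee_fin; exact: g0.
  + by apply: lipschitz1_measurable; apply: risk_lipschitz1; exact: two_point_lipschitz1.
  + exact: measurable_funM.
  + by move=> x; rewrite mulr_ge0 ?(ltW dr0)//= ler_piMr// ltW.
  + move=> x; apply: le_trans (risk_two_point_left _ d01 r0).
    by rewrite lerD2l -mulrA ler_wpM2l// ltW.
- move=> th th0.
  pose pA : R := (1 - delta) / 2; pose pB : R := (1 + delta) / 2.
  have pA01 : 0 < pA < 1 by rewrite /pA; apply/andP; split; lra.
  have pB01 : 0 < pB < 1 by rewrite /pB; apply/andP; split; lra.
  have := integral_bernoulli_iid_change pA01 pB01 mH H01 th0.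
  (* As pA + pB = 1, the left side is (pA^3 + pB^3) / (pA pB) = 1 / (pA pB) - 3, with pA pB = (1 -
     delta^2) / 4. *)
  have -> : pB ^+ 2 / pA + (1 - pB) ^+ 2 / (1 - pA) = 4 / (1 - delta ^+ 2) - 3.
    have dd : 1 - delta ^+ 2 = (1 - delta) * (1 + delta) by ring.
    by rewrite dd /pA /pB; field; apply/andP; split; lra.
  rewrite -[X in (X <= _)%E]/(I pB) -[X in (_ <= _ * X + _)%E]/(I pA).
  rewrite (fI pA) (fI pB) -EFinM -EFinD lee_fin => bnd.
  apply: le_trans (@Err_inst_ge _ _ _ _ r (fun x => delta * r * (1 - g x)) (delta * r) _ _ _ _).
  + apply: (@le_trans _ _ (delta * r * (1 - fine (I pB)))%:E).
      by rewrite lee_fin ler_pM2l// -addrA lerD2l -opprD lerN2.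
    under eq_integral do rewrite mulrBr mulr1 -mulNr.
    have ig : (iid (law (two_point ((1 + delta) / 2) r)) T \x U)%E.-integrable
        setT (EFin \o phi).
      apply: (@bounded_integrable _ _ _ _ 1); first exact/measurable_EFinP.
      by move=> w; rewrite ger0_norm; [exact: g1|exact: g0].
    rewrite integral_cstD; last first.
      exact: (integrableZl _ (- (delta * r)) ig).
    under eq_integral do rewrite EFinM.
    rewrite integralZl//.
    rewrite [X in (_ <= _ + _ * X)%E](IE pB) fI.
    by rewrite -EFinM -EFinD lee_fin mulrBr mulr1 mulNr.
  + by apply: lipschitz1_measurable; apply: risk_lipschitz1; exact: two_point_lipschitz1.
  + by apply: measurable_funM => //; exact: measurable_funB.
  + by move=> x; rewrite mulr_ge0 ?(ltW dr0) ?subr_ge0//= ler_piMr ?(ltW dr0)// gerBl.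
  + move=> x; apply: le_trans (risk_two_point_right _ d01 r0).
    by rewrite lerD2l -mulrA ler_wpM2l// ltW.
Qed.

End lower_bound.

(** * Price of adaptivity *)

Section price_of_adaptivity.
Variable R : realType.

Lemma le_ediv (a b : R) (e D : \bar R) : 0 <= a -> 0 < b ->
  (a%:E <= e)%E -> (0 <= D <= b%:E)%E -> ((a / b)%:E <= e / D)%E.
Proof.
move=> a0 b0 ae /andP[D0 Db].
have iD : (b^-1%:E <= inve D)%E.
  move: D0 Db; case: D => [y||//]; last by rewrite leye_eq.
  (* The inverse of 0 is +oo, so the bound persists for a zero denominator. *)
  rewrite !lee_fin /inve => y0 yb; case: eqP => [_|/eqP y_neq0]; first exact: leey.
  have y_gt0 : 0 < y by rewrite lt0r y_neq0.
  by rewrite lee_fin lef_pV2.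
rewrite EFinM; apply: lee_pmul => //; rewrite lee_fin// invr_ge0.
exact: ltW.
Qed.

Lemma two_point_left_I_Lip (delta r rho : R) : 0 < delta < 1 -> 0 < r ->
  0 <= rho -> I_Lip 1 rho (two_point ((1 - delta) / 2) r).
Proof.
move=> d01 r0 rho0; have /andP[d0 _] := d01.
apply: (@two_point_I_Lip _ _ _ _ 0); last by rewrite normr0.
move=> x; apply: le_trans (risk_two_point_left x d01 r0).
by rewrite lerDl mulr_ge0// ltW.
Qed.

Lemma two_point_right_I_Lip (delta r : R) : 0 < delta < 1 -> 0 < r ->
  I_Lip 1 r (two_point ((1 + delta) / 2) r).
Proof.
move=> d01 r0; have /andP[d0 _] := d01.
apply: (@two_point_I_Lip _ _ _ _ r); last by rewrite gtr0_norm.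
move=> x; apply: le_trans (risk_two_point_right x d01 r0).
by rewrite lerDl mulr_ge0// ltW.
Qed.

Lemma Err_inst_le_class (T : nat) (alg : SOalg R) (C : inst_class R) p :
  C p -> (Err_inst T alg p <= Err_class T alg C)%E.
Proof. by move=> Cp; apply: ereal_sup_ubound; exists p. Qed.

(** One member of the class suffices for a supremum: a two-point instance minimized at 0 lies in the
    class for every radius. This gives the sign of the denominator in [PoA]. *)
Lemma Err_class_ge0 (T : nat) (alg : SOalg R) (rho : R) : 0 <= rho ->
  (0 <= Err_class T alg (I_Lip 1 rho))%E.
Proof.
move=> rho0; have d01 : 0 < (2^-1 : R) < 1 by apply/andP; split; lra.
have [a [a0 aErr _]] := two_point_separation T alg ltr01 d01.
apply: le_trans (Err_inst_le_class T alg (two_point_left_I_Lip d01 ltr01 rho0)).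
by apply: le_trans aErr; rewrite lee_fin !mulr_ge0// invr_ge0.
Qed.

Lemma PoA_ge (T : nat) (alg : SOalg R) (r rho a : R) : (0 < T)%N ->
  1 <= r <= rho -> 0 <= a -> (a%:E <= Err_class T alg (I_Lip 1 r))%E ->
  ((a / (12 * r / Num.sqrt T%:R))%:E <= PoA T alg (M_Lip 1 rho))%E.
Proof.
move=> T0 r1rho a0 aErr; have /andP[r1 _] := r1rho.
have r0 : 0 < r by apply: lt_le_trans r1.
apply: le_ereal_sup_tmp.
exists (Err_class T alg (I_Lip 1 r) / Err_minimax T (I_Lip 1 r))%E.
  by exists (I_Lip 1 r) => //; exists 1, r; rewrite lexx.
apply: le_ediv => //.
  by rewrite divr_gt0 ?mulr_gt0// sqrtr_gt0 ltr0n.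
rewrite Err_minimax_le// andbT.
by apply: le_ereal_inf_tmp => _ [alg' _ <-]; apply: Err_class_ge0; exact: ltW.
Qed.

(** With u = delta^2 <= 1/2, the base is 1 + 4 u / (1 - u) <= 1 + 8 u <= exp(8 u), and 8 u T <= ln
    rho / 2. *)
Lemma chi2_power_le (T : nat) (delta rho : R) : 1 <= rho -> 0 <= delta ->
  delta <= 4^-1 -> delta ^+ 2 * T%:R <= ln rho / 16 ->
  (4 / (1 - delta ^+ 2) - 3) ^+ T <= rho.
Proof.
move=> rho1 d0 d4 dT; have rho0 : 0 < rho by apply: lt_le_trans rho1.
have d2 : delta ^+ 2 <= 2^-1 by nra.
have d2' : 0 <= delta ^+ 2 by rewrite sqr_ge0.
have M0 : 0 <= 4 / (1 - delta ^+ 2) - 3.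
  by rewrite subr_ge0 ler_pdivlMr; lra.
have M8 : 4 / (1 - delta ^+ 2) - 3 <= expR (8 * delta ^+ 2).
  apply: le_trans (expR_ge1Dx _).
  by rewrite lerBlDr ler_pdivrMr; nra.
apply: (@le_trans _ _ (expR (8 * delta ^+ 2) ^+ T)).
  by rewrite lerXn2r// nnegrE// expR_ge0.
rewrite -expRM_natr -[leRHS](lnK rho0) ler_expR.
have : 0 <= ln rho by rewrite ln_ge0.
lra.
Qed.

End price_of_adaptivity.

Theorem theorem1 (R : realType) :
  exists c : R, 0 < c /\
    forall (T : nat) (rho : R) (alg : SOalg R), (0 < T)%N -> 1 <= rho ->
      ((c * Num.min (Num.sqrt (ln rho)) (Num.sqrt T%:R))%:E
        <= PoA T alg (M_Lip 1 rho))%E.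
Proof.
(* The constant is (3 / 8) / (4 * 12): error threshold 3 / 8, factor 4 in [delta], factor 12 in the
   minimax bound. *)
exists 128^-1; split; first by rewrite invr_gt0.
move=> T rho alg T0 rho1; have rho0 : 0 < rho by apply: lt_le_trans rho1.
set m := Num.min _ _.
have s0 : 0 < Num.sqrt T%:R :> R by rewrite sqrtr_gt0 ltr0n.
have ms : m <= Num.sqrt T%:R by rewrite /m ge_min lexx orbT.
have ml : m <= Num.sqrt (ln rho) by rewrite /m ge_min lexx.
have : 0 <= m by rewrite /m le_min !sqrtr_ge0.
(* The value m = 0 occurs exactly for rho = 1; there [delta] would vanish and only nonnegativity of
   [PoA] is claimed. *)
rewrite le_eqVlt => /predU1P[<-|m0].
  rewrite mulr0; have := @PoA_ge R T alg 1 rho 0 T0.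
  by rewrite mul0r lexx; apply=> //; exact: Err_class_ge0.
(* Then delta^2 T = m^2 / 16 <= ln rho / 16, and m <= sqrt T gives delta <= 1/4, as [chi2_power_le]
   requires. *)
pose delta := m / (4 * Num.sqrt T%:R).
have d0 : 0 < delta by rewrite divr_gt0 ?mulr_gt0.
have d4 : delta <= 4^-1.
  by rewrite ler_pdivrMr ?mulr_gt0// mulrA mulVf ?mul1r.
have d01 : 0 < delta < 1 by apply/andP; split; lra.
have dT : delta ^+ 2 * T%:R <= ln rho / 16.
  have -> : delta ^+ 2 * T%:R = m ^+ 2 / 16.
    rewrite /delta -[T%:R in X in _ * X](sqr_sqrtr (ler0n R T)); field.
    by rewrite gt_eqF.
  rewrite ler_pM2r//; apply: (@le_trans _ _ (Num.sqrt (ln rho) ^+ 2)).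
    by rewrite lerXn2r ?nnegrE ?sqrtr_ge0// ltW.
  by rewrite sqr_sqrtr// ln_ge0.
have [a [a0 aErr bErr]] := two_point_separation T alg rho0 d01.
have mE : 128^-1 * m = delta * (3 / 8) / (12 * 1 / Num.sqrt T%:R).
  by rewrite /delta; field; rewrite gt_eqF.
have mE' : 128^-1 * m = delta * rho * (3 / 8) / (12 * rho / Num.sqrt T%:R).
  by rewrite /delta; field; rewrite !gt_eqF.
have [ra|ra] := leP (3 / 8) (rho * a).
- rewrite mE; apply: PoA_ge; [exact: T0|by rewrite lexx| |].
    by rewrite mulr_ge0// ltW.
  apply: le_trans (Err_inst_le_class T alg (two_point_left_I_Lip d01 rho0 ler01)).
  by apply: le_trans aErr; rewrite lee_fin -mulrA ler_pM2l.
- rewrite mE'; apply: PoA_ge; [exact: T0|by rewrite rho1 lexx| |].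
    by rewrite !mulr_ge0// ltW.
  apply: le_trans (Err_inst_le_class T alg (two_point_right_I_Lip d01 rho0)).
  (* With theta = rho, the subtracted terms are below 3/8 and at most 1/4, leaving at least 1 - 3/8
     - 1/4 = 3/8, the threshold of the case split. *)
  apply: le_trans (bErr _ rho0).
  rewrite lee_fin ler_pM2l; last exact: mulr_gt0.
  have : (4 / (1 - delta ^+ 2) - 3) ^+ T / (4 * rho) <= 1 / 4.
    rewrite ler_pdivrMr ?mulr_gt0//; apply: le_trans (chi2_power_le rho1 (ltW d0) d4 dT) _.
    lra.
  lra.
Qed.
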